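(* Let $P$ be a convex polygon in $\mathbb{R}^2$ and write $\delta=\delta(P)$. For every distinguished chord $[p_0,q_0]$ of $P$ there exists a refined section $S$ of $P$ with $\delta=d_S(y(S))$ such that at least one of the following holds: (i) $p_0\in\overline{S}$ is the nearest point of $\overline{S}$ to $y(S)$ (so $\delta=d_S(y(S))=d(p_0,y(S))$), and $q_0=y(S)$; (ii) $p_0$ is the initial point of $S$, and $q_0$ is a vertex of $P$ with $q_0\neq p_0$ and $\delta=d(p_0,y(S))=d(p_0,q_0)$.
   Context: A convex polygon $P$ is the closed polygonal curve (union of its edges) bounding a compact convex region of $\mathbb{R}^2$ with nonempty interior; it is oriented counterclockwise. $d$ is the Euclidean distance and $\delta(P):=\min_{p\in P}\max_{q\in P} d(p,q)$. A pair $(p_0,q_0)$ of points of $P$ is distinguished if $\delta(P)=d(p_0,q_0)\geq d(p_0,q)$ for all $q\in P$; the segment $[p_0,q_0]$ is then called a distinguished chord (the order of the endpoints matters). Section points of $P$: the (finitely many) intersection points with $P$ of the perpendicular bisectors of all pairs of distinct vertices of $P$. Sections: the connected components of $P$ minus the section points. Refined sections: the connected components of $P$ minus the section points and the vertices; each refined section $S$ is an open segment contained in an edge of $P$. All points of a (refined) section $S$ have one and the same unique farthest point on $P$, which is a vertex and is denoted $y(S)$. $\overline{S}$ is the closure of $S$ ($S$ with its two endpoints), and the initial point of $S$ is the endpoint at which $S$ starts in the orientation of $P$. For a nonempty set $T\subset\mathbb{R}^2$ and $z\in\mathbb{R}^2$, $d_T(z):=\inf\{d(p,z)\mid p\in T\}$;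 thus $d_S=d_{\overline{S}}$. *)

(* Defs.v *)
From mathcomp Require Import all_boot all_order all_algebra.
From mathcomp Require Import all_classical all_reals all_analysis.

Set Implicit Arguments.
Unset Strict Implicit.
Unset Printing Implicit Defensive.

Import Order.TTheory GRing.Theory Num.Theory.
Import numFieldNormedType.Exports.

Local Open Scope classical_set_scope.
Local Open Scope ring_scope.

Section Plane.
Context {R : realType}.
Implicit Types a b c p q z : 'rV[R]_2.

Definition xcoord z : R := z 0 0.
Definition ycoord z : R := z 0 1.

Definition dot p q : R := xcoord p * xcoord q + ycoord p * ycoord q.

(* The library norm on 'rV[R]_2 is the max norm; only its topology is used. *)
Definition eucl_dist p q : R := Num.sqrt (dot (p - q) (p - q)).

(* Twice the signed area of the triangle (a, b, c): positive when c lies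
   strictly to the left of the oriented line from a to b. *)
Definition cross a b c : R :=
  xcoord (b - a) * ycoord (c - a) - ycoord (b - a) * xcoord (c - a).

Definition perp_bisector a b : set 'rV[R]_2 :=
  [set z | dot (z - 2^-1 *: (a + b)) (b - a) = 0].

Definition dist_to_set (T : set 'rV[R]_2) z : R :=
  inf [set eucl_dist p z | p in T].

(* For the compact nonempty P considered here, inf and sup are attained. *)
Definition delta (P : set 'rV[R]_2) : R :=
  inf [set sup [set eucl_dist p q | q in P] | p in P].

Definition distinguished (P : set 'rV[R]_2) p q : Prop :=
  [/\ P p, P q, delta P = eucl_dist p q
    & forall q', P q' -> eucl_dist p q' <= eucl_dist p q].

End Plane.

(* A polygon is given by its cyclic sequence of vertices v 0, ..., v (n - 1);
   ordS is the cyclic successor. *)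
Section Polygon.
Context {R : realType} {n : nat}.
Variable v : 'I_n -> 'rV[R]_2.

Definition edge_point (i : 'I_n) (t : R) : 'rV[R]_2 :=
  (1 - t) *: v i + t *: v (ordS i).

Definition polygon_curve : set 'rV[R]_2 :=
  [set z | exists i, exists2 t, 0 <= t <= 1 & z = edge_point i t].

(* The conditions cp_inj and cp_corner say that the v i are genuine corners,
   each listed once; the last clause on K is the counterclockwise orientation
   (the region lies to the left of every oriented edge). *)
Record convex_polygon : Prop := ConvexPolygon {
  cp_inj : injective v ;
  cp_corner : forall i, cross (v i) (v (ordS i)) (v (ordS (ordS i))) != 0 ;
  cp_region : exists K : set 'rV[R]_2,
    [/\ compact K, convex_set K, K° !=set0,
        closure K `\` K° = polygon_curve
      & forall i z, K z -> 0 <= cross (v i) (v (ordS i)) z]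
}.

Definition section_points : set 'rV[R]_2 :=
  [set z | polygon_curve z /\
     exists i j, i != j /\ perp_bisector (v i) (v j) z].

Definition refined_section (S : set 'rV[R]_2) : Prop :=
  let A := polygon_curve `\` (section_points `|` range v) in
  exists2 x, A x & S = connected_component A x.

(* y is y(S): the vertex that is the unique farthest point of the polygon
   from every point of S. *)
Definition farthest_vertex (S : set 'rV[R]_2) (y : 'rV[R]_2) : Prop :=
  range v y /\ forall p q, S p -> polygon_curve q -> q != y ->
    eucl_dist p q < eucl_dist p y.

(* The orientation runs along each edge from v i to v (ordS i). *)
Definition initial_point (S : set 'rV[R]_2) (p : 'rV[R]_2) : Prop :=
  exists i s t, [/\ 0 <= s, s < t, t <= 1,
    S = [set edge_point i r | r in `]s, t[] & p = edge_point i s].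

End Polygon.

Definition nearest_point {R : realType} (T : set 'rV[R]_2) (z p : 'rV[R]_2) :
    Prop :=
  T p /\ forall p', T p' -> p' != p -> eucl_dist p z < eucl_dist p' z.

(* Main.v *)
(* Write p0 = (1 - x) v_i + x v_(i+1) with 0 <= x < 1.  No perpendicular bisector
   of two vertices contains an edge, so edge i carries finitely many section
   points, and there is a refined section S = ](s), (t)[ on edge i with
   s <= x < t.  Along S the differences of squared distances to two vertices
   are affine without zeros, so one vertex y is strictly farthest from all of S.
   Hence delta <= d(., y) on S, and on its closure by continuity, with equality
   at p0 because d(p0, y) <= d(p0, q0) = delta; strict convexity of the squared
   distance makes p0 the only minimizer.  Either q0 = y, which is (i), or
   p0 is not in S, so x = s, which is (ii). *)
Require Import Defs.
From mathcomp Require Import all_boot all_order all_algebra.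
From mathcomp Require Import all_classical all_reals all_analysis.
From mathcomp Require Import ring lra.
Import Order.TTheory GRing.Theory Num.Theory.
Import numFieldNormedType.Exports.
Local Open Scope classical_set_scope.
Local Open Scope ring_scope.

Set Implicit Arguments.
Unset Strict Implicit.
Unset Printing Implicit Defensive.

(** * Euclidean plane geometry in coordinates *)

Section PlaneGeometry.
Context {R : realType}.
Implicit Types a b c p q w z : 'rV[R]_2.

Lemma coordP p q : xcoord p = xcoord q -> ycoord p = ycoord q -> p = q.
Proof.
move=> hx hy; apply/rowP => k.
have [->|->] : k = 0 \/ k = 1.
  by case: k => -[|[|//]] lt; [left|right]; apply/val_inj.
- exact: hx.
- exact: hy.
Qed.

Lemma xcoordB p q : xcoord (p - q) = xcoord p - xcoord q.
Proof. by rewrite /xcoord !mxE. Qed.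

Lemma ycoordB p q : ycoord (p - q) = ycoord p - ycoord q.
Proof. by rewrite /ycoord !mxE. Qed.

Lemma xcoordD p q : xcoord (p + q) = xcoord p + xcoord q.
Proof. by rewrite /xcoord !mxE. Qed.

Lemma ycoordD p q : ycoord (p + q) = ycoord p + ycoord q.
Proof. by rewrite /ycoord !mxE. Qed.

Lemma xcoordZ t p : xcoord (t *: p) = t * xcoord p.
Proof. by rewrite /xcoord !mxE. Qed.

Lemma ycoordZ t p : ycoord (t *: p) = t * ycoord p.
Proof. by rewrite /ycoord !mxE. Qed.

Definition coordE :=
  (xcoordB, ycoordB, xcoordD, ycoordD, xcoordZ, ycoordZ).

Definition sqdist p q : R := dot (p - q) (p - q).

Lemma sqdistE p q :
  sqdist p q = (xcoord p - xcoord q) ^+ 2 + (ycoord p - ycoord q) ^+ 2.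
Proof. by rewrite /sqdist /dot !coordE !expr2. Qed.

Lemma sqdistC p q : sqdist p q = sqdist q p.
Proof. by rewrite !sqdistE; ring. Qed.

Lemma sqdist_ge0 p q : 0 <= sqdist p q.
Proof. by rewrite sqdistE addr_ge0 // sqr_ge0. Qed.

Lemma sqdist_gt0 p q : (0 < sqdist p q) = (p != q).
Proof.
rewrite lt_neqAle sqdist_ge0 andbT eq_sym; congr (~~ _); apply/eqP/eqP => [|->].
  rewrite sqdistE => /eqP; rewrite paddr_eq0 ?sqr_ge0// !sqrf_eq0 !subr_eq0.
  by case/andP => /eqP + /eqP; exact: coordP.
by rewrite sqdistE !subrr expr0n addr0.
Qed.

Lemma ler_eucl_dist p q p' q' :
  (eucl_dist p q <= eucl_dist p' q') = (sqdist p q <= sqdist p' q').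
Proof. by rewrite /eucl_dist ler_sqrt // sqdist_ge0. Qed.

Lemma ltr_eucl_dist p q p' q' :
  (eucl_dist p q < eucl_dist p' q') = (sqdist p q < sqdist p' q').
Proof. by rewrite !ltNge ler_eucl_dist. Qed.

Lemma eucl_dist_ge0 p q : 0 <= eucl_dist p q.
Proof. exact: sqrtr_ge0. Qed.

Lemma eucl_dist_gt0 p q : (0 < eucl_dist p q) = (p != q).
Proof. by rewrite -sqdist_gt0 /eucl_dist sqrtr_gt0. Qed.

(** Stewart's theorem. The quadratic term does not involve [z], so it cancels when squared distances
    to two points are compared. *)
Lemma sqdist_segment z a b t :
  sqdist ((1 - t) *: a + t *: b) z =
  (1 - t) * sqdist a z + t * sqdist b z - t * (1 - t) * sqdist a b.
Proof. by rewrite !sqdistE !coordE; ring. Qed.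

Lemma sqdist_midpoint_lt z p q : p != q -> sqdist p z = sqdist q z ->
  sqdist ((1 - 2^-1) *: p + 2^-1 *: q) z < sqdist p z.
Proof. by rewrite -sqdist_gt0 sqdist_segment => pq <-; lra. Qed.

Lemma perp_bisectorE a b z : perp_bisector a b z <-> sqdist z a = sqdist z b.
Proof.
rewrite /perp_bisector /= !sqdistE /dot !coordE.
by split=> H; lra.
Qed.

Lemma cross_segment a b p q t :
  cross a b ((1 - t) *: p + t *: q) = (1 - t) * cross a b p + t * cross a b q.
Proof. by rewrite /cross !coordE; ring. Qed.

Lemma cross_rot a b c : cross b c a = cross a b c.
Proof. by rewrite /cross !coordE; ring. Qed.

Lemma cross_first a b : cross a b a = 0.
Proof. by rewrite /cross !coordE; ring. Qed.

Lemma cross_second a b : cross a b b = 0.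
Proof. by rewrite /cross; ring. Qed.

Lemma cross_eq0_line a b z : a != b -> cross a b z = 0 ->
  exists t, z = (1 - t) *: a + t *: b.
Proof.
rewrite -sqdist_gt0 sqdistE /cross !coordE => d_gt0 h.
set d := (X in 0 < X) in d_gt0; have dn0 : d != 0 by rewrite gt_eqF.
(* [N / d] is the parameter of the orthogonal projection of [z] onto the line. After multiplication
   by [d], each coordinate of the error is a multiple of [cross a b z]. *)
set N := (xcoord z - xcoord a) * (xcoord b - xcoord a) +
         (ycoord z - ycoord a) * (ycoord b - ycoord a).
have tN : N / d * d = N by rewrite divfK.
exists (N / d); apply: coordP; rewrite !coordE; apply/(mulIf dn0)/eqP;
  rewrite -subr_eq0; apply/eqP.
  transitivity ((xcoord z - xcoord a) * d
      - N / d * d * (xcoord b - xcoord a)); first by ring.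
  by rewrite tN -(mulr0 (ycoord a - ycoord b)) -h /N /d; ring.
transitivity ((ycoord z - ycoord a) * d
    - N / d * d * (ycoord b - ycoord a)); first by ring.
by rewrite tN -(mulr0 (xcoord b - xcoord a)) -h /N /d; ring.
Qed.

(** The topology is that of the max norm, so continuity goes through the two coordinates. *)
Lemma eucl_dist_continuous z : continuous (fun p => eucl_dist p z).
Proof.
have norm_continuous (T : topologicalType) (f g : T -> R) (a b : R) :
    continuous f -> continuous g ->
    continuous (fun x =>
      Num.sqrt ((f x - a) * (f x - a) + (g x - b) * (g x - b))).
  move=> cf cg x0; apply: continuous_comp; last exact: sqrt_continuous.
  have cfa : f x - a @[x --> x0] --> f x0 - a.
    by apply: cvgB; [exact: cf | exact: cvg_cst].
  have cgb : g x - b @[x --> x0] --> g x0 - b.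
    by apply: cvgB; [exact: cg | exact: cvg_cst].
  exact: (cvgD (cvgM cfa cfa) (cvgM cgb cgb)).
have -> : (fun p => eucl_dist p z) = (fun p =>
    Num.sqrt ((xcoord p - xcoord z) * (xcoord p - xcoord z) +
              (ycoord p - ycoord z) * (ycoord p - ycoord z))).
  by apply/funext => q; rewrite /eucl_dist /dot !coordE.
by apply: norm_continuous => p; exact: coord_continuous.
Qed.

Lemma closure_eucl_dist_ge (T : set 'rV[R]_2) r p z : closure T p ->
  (forall q, T q -> r <= eucl_dist q z) -> r <= eucl_dist p z.
Proof.
move=> Tp rT; have : closed ((fun q => eucl_dist q z) @^-1` [set x | r <= x]).
  apply: preimage_closed; last exact: closed_ge.
  by move=> q _; exact: eucl_dist_continuous.
by apply; apply: closureS Tp.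
Qed.

End PlaneGeometry.

(** * Affine functions on the line and gaps of finite sets *)

Lemma affine_two_zeros {R : realType} (A B c d : R) : c != d ->
  (1 - c) * A + c * B = 0 -> (1 - d) * A + d * B = 0 -> A = 0 /\ B = 0.
Proof.
move=> cd hc hd.
have AB : B = A.
  have /eqP : (c - d) * (B - A) = 0 by rewrite -[RHS](subrr 0) -{1}hc -hd; ring.
  by rewrite mulf_eq0 !subr_eq0 (negPf cd) => /eqP.
by move: hc; rewrite AB -mulrDl subrK mul1r.
Qed.

Lemma affine_constant_sign {R : realType} (A B s t r r' : R) :
  (forall u, s < u < t -> (1 - u) * A + u * B != 0) ->
  s < r < t -> s < r' < t ->
  0 < (1 - r) * A + r * B -> 0 < (1 - r') * A + r' * B.
Proof.
move=> nz rst r'st fr; rewrite ltNge; apply/negP => fr'.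
set x := (1 - r) * A + r * B in fr; set y := (1 - r') * A + r' * B in fr'.
have xy_gt0 : 0 < x - y by lra.
(* If the sign changed, the affine function, with values [x] at [r] and [y] at [r'], would vanish at
   [r + l * (r' - r)], between [r] and [r']. *)
set l := x / (x - y).
have l01 : 0 <= l <= 1.
  by rewrite /l ler_pdivrMr// mul1r (divr_ge0 (ltW fr) (ltW xy_gt0)); lra.
suff /negP[] : (1 - (r + l * (r' - r))) * A + (r + l * (r' - r)) * B != 0.
  have -> : (1 - (r + l * (r' - r))) * A + (r + l * (r' - r)) * B =
            x - l * (x - y) by rewrite /x /y; ring.
  by rewrite divfK ?subrr// gt_eqF.
by apply: nz; case: (leP r r') => rr'; nra.
Qed.

(** Induction on [l]: a new point [c] replaces an end only if it falls strictly between [s] and [t],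
    and becomes the left end when [c <= x]. Thus [s = x] whenever [x] belongs to [l]. *)
Lemma seq_gap {R : realType} (l : seq R) (x a b : R) : a <= x < b ->
  exists s t, [/\ s \in a :: l, t \in b :: l, a <= s <= x, x < t <= b
    & forall r, r \in l -> r <= s \/ t <= r].
Proof.
move=> /andP[ax xb]; elim: l => [|c l [s [t [sl tl /andP[as_ sx] /andP[xt tb] gap]]]].
  by exists a, b; rewrite !mem_head lexx ax xb lexx.
have wk (e d : R) : d \in e :: l -> d \in [:: e, c & l].
  by rewrite !inE => /orP[->//|->]; rewrite !orbT.
have [sc|cs] := ltP s c; last first.
  exists s, t; split; rewrite ?wk ?as_ ?sx ?xt ?tb//.
  by move=> r; rewrite inE => /orP[/eqP->|/gap//]; left.
have [tc|ct] := leP t c.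
  exists s, t; split; rewrite ?wk ?as_ ?sx ?xt ?tb//.
  by move=> r; rewrite inE => /orP[/eqP->|/gap//]; right.
have [cx|xc] := leP c x.
  exists c, t; split; rewrite ?(wk b t) ?xt ?tb ?cx ?andbT//.
  - by rewrite !inE eqxx orbT.
  - lra.
  move=> r; rewrite inE => /orP[/eqP->|/gap[]]; [by left|left; lra|by right].
exists s, c; split; rewrite ?(wk a s) ?as_ ?sx ?xc//=.
- by rewrite !inE eqxx orbT.
- lra.
by move=> r; rewrite inE => /orP[/eqP->|/gap[]]; [right|left|right; lra].
Qed.

(** * Edges of a convex polygon *)

Section Edges.
Context {R : realType} {n : nat}.
Variable v : 'I_n -> 'rV[R]_2.
Hypothesis v_convex : convex_polygon v.
Local Notation P := (polygon_curve v).
Local Notation ep := (edge_point v).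
Implicit Types (i j : 'I_n) (r s t u : R) (p q z : 'rV[R]_2).

Lemma edge_point0 i : ep i 0 = v i.
Proof. by rewrite /edge_point subr0 scale1r scale0r addr0. Qed.

Lemma edge_point1 i : ep i 1 = v (ordS i).
Proof. by rewrite /edge_point subrr scale0r scale1r add0r. Qed.

Lemma edge_point_curve i t : 0 <= t <= 1 -> P (ep i t).
Proof. by move=> t01; exists i, t. Qed.

Lemma vertex_curve i : P (v i).
Proof. by rewrite -edge_point0; apply: edge_point_curve; rewrite lexx ler01. Qed.

Lemma edge_point_convex i s t r :
  ep i ((1 - r) * s + r * t) = (1 - r) *: ep i s + r *: ep i t.
Proof. by apply: coordP; rewrite !coordE; ring. Qed.

Lemma sqdist_edge_point i t u :
  sqdist (ep i t) (ep i u) = (t - u) ^+ 2 * sqdist (v i) (v (ordS i)).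
Proof. by rewrite !sqdistE !coordE; ring. Qed.

Lemma edge_nondegenerate i : v i != v (ordS i).
Proof.
apply/eqP => e; have := cp_corner v_convex i; rewrite -e /cross !coordE.
by rewrite !subrr !mul0r subrr eqxx.
Qed.

Lemma edge_point_inj i : injective (ep i).
Proof.
move=> t u e; have := sqdist_edge_point i t u.
rewrite e sqdistE !subrr expr0n addr0 => /esym/eqP.
rewrite mulf_eq0 sqrf_eq0 subr_eq0 => /orP[/eqP//|].
by rewrite gt_eqF // sqdist_gt0 edge_nondegenerate.
Qed.

Lemma edge_point_continuous i : continuous (ep i).
Proof.
move=> t; apply: cvgD; apply: cvgZ; try exact: cvg_cst.
  by apply: cvgB; [exact: cvg_cst | exact: cvg_id].
exact: cvg_id.
Qed.

Lemma closed_edge_segment i s t : closed [set ep i r | r in `[s, t]].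
Proof.
apply: compact_closed; first exact: norm_hausdorff.
apply: continuous_compact; last exact: segment_compact.
by apply: continuous_subspaceT => r; exact: edge_point_continuous.
Qed.

Lemma closure_edge_interval i s t : s < t ->
  closure [set ep i r | r in `]s, t[] = [set ep i r | r in `[s, t]].
Proof.
move=> st; apply/seteqP; split.
  have /closure_id -> := @closed_edge_segment i s t.
  apply: closureS => _ [r rst <-]; exists r => //.
  by move: rst; rewrite /= !in_itv /= => /andP[/ltW -> /ltW ->].
move=> _ [r + <-]; rewrite /= in_itv /= => rst.
(* By continuity it suffices that [r] is adherent to the parameters in []s, t[]: move right from [r]
   by a small amount, or left when [r = t]. *)
set C := closure _; have cC : closed (ep i @^-1` C).
  apply: preimage_closed; last exact: closed_closure.
  by move=> x _; exact: edge_point_continuous.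
apply: cC => B /nbhs_ballP[e /= e0 eB].
have inC u : s < u < t -> C (ep i u).
  by move=> sut; apply: subset_closure; exists u; rewrite //= in_itv.
have [rt|tr] := ltP r t.
  exists (r + Num.min e (t - r) / 2); split; last first.
    apply: eB; rewrite /ball /= opprD addrA subrr add0r normrN.
    by rewrite ger0_norm; case: (leP e (t - r)); lra.
  by apply: inC; case: (leP e (t - r)); lra.
exists (r - Num.min e (t - s) / 2); split; last first.
  apply: eB; rewrite /ball /= opprB addrC subrK.
  by rewrite ger0_norm; case: (leP e (t - s)); lra.
by apply: inC; case: (leP e (t - s)); lra.
Qed.

Lemma cross_edge_point j i t : cross (v j) (v (ordS j)) (ep i t) =
  (1 - t) * cross (v j) (v (ordS j)) (v i) +
  t * cross (v j) (v (ordS j)) (v (ordS i)).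
Proof. exact: cross_segment. Qed.

(** A compact [K] is closed, so its boundary lies in [K], where the orientation clause applies. *)
Lemma curve_left i z : P z -> 0 <= cross (v i) (v (ordS i)) z.
Proof.
have [K [cK _ _ <- leftK]] := cp_region v_convex.
have /closure_id <- := compact_closed (@norm_hausdorff _ _) cK.
by move=> [Kz _]; exact: leftK.
Qed.

Lemma corner_gt0 i : 0 < cross (v i) (v (ordS i)) (v (ordS (ordS i))).
Proof.
by rewrite lt_neqAle eq_sym cp_corner// curve_left//; exact: vertex_curve.
Qed.

(** At the point of parameter [t] on the line of edge [i], the half-plane of the next edge gives
    [t <= 1] and that of the previous edge gives [0 <= t], since both corners are strictly
    positive. *)
Lemma supporting_line_edge i z : P z -> cross (v i) (v (ordS i)) z = 0 ->
  exists2 t, 0 <= t <= 1 & z = ep i t.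
Proof.
move=> Pz /(cross_eq0_line (edge_nondegenerate i))[t zt]; exists t => //.
have := curve_left (ordS i) Pz; have := curve_left (ord_pred i) Pz.
have := corner_gt0 i; have := corner_gt0 (ord_pred i).
rewrite ord_predK zt !cross_segment.
rewrite cross_second cross_first (cross_rot (v i)) !mulr0 addr0 add0r => hp hi.
by rewrite pmulr_lge0// pmulr_lge0// => -> /=; rewrite subr_ge0.
Qed.

(** An affine function that is nonnegative at both ends of edge [i] and zero inside it vanishes at
    both ends. So edge [i] lies in edge [j]; the two lines then agree, the reverse inclusion
    follows, and the edges have the same ends. *)
Lemma edge_interior_disjoint i j r u :
  0 < r < 1 -> 0 <= u <= 1 -> ep i r = ep j u -> i = j.
Proof.
move=> r01 u01 e.
have : cross (v j) (v (ordS j)) (ep i r) = 0.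
  by rewrite e cross_edge_point cross_first cross_second !mulr0 addr0.
have L0 := curve_left j (vertex_curve i).
have L1 := curve_left j (vertex_curve (ordS i)).
rewrite cross_edge_point => L.
have Z0 : cross (v j) (v (ordS j)) (v i) = 0 by nra.
have Z1 : cross (v j) (v (ordS j)) (v (ordS i)) = 0 by nra.
have [c c01 ic] := supporting_line_edge (vertex_curve i) Z0.
have [d d01 id_] := supporting_line_edge (vertex_curve (ordS i)) Z1.
have cd : c != d.
  by apply: contraTneq (edge_nondegenerate i) => cd; rewrite ic id_ cd eqxx.
have [A0 A1] : cross (v i) (v (ordS i)) (v j) = 0 /\
               cross (v i) (v (ordS i)) (v (ordS j)) = 0.
  by apply: (affine_two_zeros cd); rewrite -cross_edge_point -?ic -?id_
    ?cross_first ?cross_second.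
have [a a01 ja] := supporting_line_edge (vertex_curve j) A0.
have [b b01 jb] := supporting_line_edge (vertex_curve (ordS j)) A1.
have Di : 0 < sqdist (v i) (v (ordS i)) by rewrite sqdist_gt0 edge_nondegenerate.
have Dj : 0 < sqdist (v j) (v (ordS j)) by rewrite sqdist_gt0 edge_nondegenerate.
have Eij := sqdist_edge_point i a b; rewrite -ja -jb in Eij.
have Eji := sqdist_edge_point j c d; rewrite -ic -id_ in Eji.
(* The two factors relating the squared edge lengths are at most 1 and have product 1. *)
have ab1 : (a - b) ^+ 2 = 1.
  have : (a - b) ^+ 2 <= 1 by nra.
  have : (c - d) ^+ 2 <= 1 by nra.
  by nra.
have [[a0 b1]|[a1 b0]] : (a = 0 /\ b = 1) \/ (a = 1 /\ b = 0).
- have /eqP : (a - b - 1) * (a - b + 1) = 0 by rewrite -[RHS](subrr 1) -{3}ab1; ring.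
  by rewrite mulf_eq0 => /orP[]/eqP h; [right|left]; split; lra.
- by apply: (cp_inj v_convex); rewrite ja a0 edge_point0.
(* Opposite orientations: [v (ordS (ordS i))] would equal [v i], a degenerate corner. *)
- have ji : j = ordS i by apply: (cp_inj v_convex); rewrite ja a1 edge_point1.
  have := cp_corner v_convex i; rewrite -ji jb b0 edge_point0.
  by rewrite cross_first eqxx.
Qed.

(** Reflection in the line of edge [i] would swap [v a] and [v b], so their signed areas over the
    edge are opposite. Both are nonnegative, hence zero, so both vertices lie on the edge; equal
    distances to its ends make them coincide. *)
Lemma bisector_not_edge i a b : a != b ->
  sqdist (v i) (v a) = sqdist (v i) (v b) ->
  sqdist (v (ordS i)) (v a) = sqdist (v (ordS i)) (v b) -> False.
Proof.
move=> ab h0 h1.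
have Dab : 0 < sqdist (v a) (v b).
  by rewrite sqdist_gt0; apply: contra_neq ab; exact: (cp_inj v_convex).
have Di : 0 < sqdist (v i) (v (ordS i)) by rewrite sqdist_gt0 edge_nondegenerate.
have sum0 : cross (v i) (v (ordS i)) (v a) + cross (v i) (v (ordS i)) (v b) = 0.
  apply: (mulfI (lt0r_neq0 Dab)); rewrite mulr0; move: h0 h1.
  rewrite !sqdistE /cross !coordE.
  set u1 := xcoord (v i); set u2 := ycoord (v i).
  set w1 := xcoord (v (ordS i)); set w2 := ycoord (v (ordS i)).
  set a1 := xcoord (v a); set a2 := ycoord (v a).
  set b1 := xcoord (v b); set b2 := ycoord (v b).
  move=> h0 h1.
  (* The edge direction and twice the vector from [v i] to the midpoint of [v a] and [v b] are both
     orthogonal to [v b - v a], which is nonzero, so they are parallel; their cross product is the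
     sum in question. *)
  have dirE : (w1 - u1) * (b1 - a1) + (w2 - u2) * (b2 - a2) = 0 by lra.
  have midE : (a1 + b1 - 2 * u1) * (b1 - a1) +
              (a2 + b2 - 2 * u2) * (b2 - a2) = 0 by lra.
  transitivity
    (((b1 - a1) * (a2 + b2 - 2 * u2) - (b2 - a2) * (a1 + b1 - 2 * u1)) *
       ((w1 - u1) * (b1 - a1) + (w2 - u2) * (b2 - a2)) +
     ((b2 - a2) * (w1 - u1) - (b1 - a1) * (w2 - u2)) *
       ((a1 + b1 - 2 * u1) * (b1 - a1) + (a2 + b2 - 2 * u2) * (b2 - a2))).
    by ring.
  by rewrite dirE midE !mulr0 addr0.
have [La Lb] := (curve_left i (vertex_curve a), curve_left i (vertex_curve b)).
have Za : cross (v i) (v (ordS i)) (v a) = 0 by lra.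
have Zb : cross (v i) (v (ordS i)) (v b) = 0 by lra.
have [s _ sa] := supporting_line_edge (vertex_curve a) Za.
have [t _ tb] := supporting_line_edge (vertex_curve b) Zb.
move: h0 h1 Dab; rewrite sa tb -(edge_point0 i) -(edge_point1 i).
rewrite !sqdist_edge_point => /(mulIf (lt0r_neq0 Di)) h0.
move=> /(mulIf (lt0r_neq0 Di)) h1.
have st : s = t by lra.
by rewrite st subrr expr0n /= mul0r ltxx.
Qed.

(** * Distances along an edge and finiteness of the section points *)

Lemma sqdist_diff_affine i t p q :
  sqdist (ep i t) p - sqdist (ep i t) q =
  (1 - t) * (sqdist (v i) p - sqdist (v i) q) +
  t * (sqdist (v (ordS i)) p - sqdist (v (ordS i)) q).
Proof. by rewrite !sqdist_segment; ring. Qed.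

(** Strict convexity: a point inside an edge is strictly closer to [p] than the end of that edge
    farther from [p]. So farthest points are vertices. *)
Lemma vertex_or_closer p q : P q ->
  range v q \/ exists a, sqdist p q < sqdist p (v a).
Proof.
move=> [j [u u01 ->]].
have [->|u0] := eqVneq u 0; first by left; exists j; rewrite ?edge_point0.
have [->|u1] := eqVneq u 1; first by left; exists (ordS j); rewrite ?edge_point1.
right; rewrite sqdistC sqdist_segment.
have : 0 < sqdist (v j) (v (ordS j)) by rewrite sqdist_gt0 edge_nondegenerate.
have u_gt0 : 0 < u by rewrite lt_neqAle eq_sym u0; case/andP: u01.
have u_lt1 : 0 < 1 - u by rewrite subr_gt0 lt_neqAle u1; case/andP: u01.
move=> /(mulr_gt0 (mulr_gt0 u_gt0 u_lt1)).
have [le_j|lt_j] := leP (sqdist (v (ordS j)) p) (sqdist (v j) p).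
  exists j; rewrite [sqdist p _]sqdistC.
  have := ler_wpM2l (ltW u_gt0) le_j; lra.
exists (ordS j); rewrite [sqdist p _]sqdistC.
have := ler_wpM2l (ltW u_lt1) (ltW lt_j); lra.
Qed.

(** The parameter [t] ranges over the whole line of the edge, which keeps the condition purely
    algebraic; [section_pointsP] restricts it to [[0, 1]]. *)
Definition section_parameter i t :=
  exists a b, a != b /\ sqdist (ep i t) (v a) = sqdist (ep i t) (v b).

Lemma section_pointsP i t : 0 <= t <= 1 ->
  section_points v (ep i t) <-> section_parameter i t.
Proof.
move=> t01; split=> [[_ [a [b [ab /perp_bisectorE h]]]]|[a [b [ab h]]]].
  by exists a, b.
split; first exact: edge_point_curve.
by exists a, b; split=> //; apply/perp_bisectorE.
Qed.

(** Each pair of vertices contributes at most one parameter: two zeros of the affine difference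
    would put both ends of the edge on the bisector. *)
Lemma finite_section_parameter i : finite_set (section_parameter i).
Proof.
have -> : section_parameter i = \bigcup_(ab in [set ab : 'I_n * 'I_n | ab.1 != ab.2])
    [set t | sqdist (ep i t) (v ab.1) = sqdist (ep i t) (v ab.2)].
  apply/seteqP; split=> t; first by move=> [a [b [ab h]]]; exists (a, b).
  by move=> [[a b] /= ab h]; exists a, b.
apply: bigcup_finite => [|[a b] /= ab]; first exact: finite_finset.
have [[t0 h0]|none] := pselect (exists t,
    sqdist (ep i t) (v a) = sqdist (ep i t) (v b)); last first.
  rewrite (_ : [set _ | _] = set0)//.
  by apply/seteqP; split=> t //= h; apply: none; exists t.
apply: (@sub_finite_set _ _ [set t0]); last exact: finite_set1.
move=> t /= h; apply/eqP/negPn/negP => tt0.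
move: h h0 => /eqP + /eqP; rewrite -!(subr_eq0 (sqdist _ (v a))).
rewrite !sqdist_diff_affine => /eqP h /eqP h0.
have [/subr0_eq Z0 /subr0_eq Z1] := affine_two_zeros tt0 h h0.
exact: (bisector_not_edge ab Z0 Z1).
Qed.

Lemma section_interval i x : 0 <= x < 1 -> exists s t,
  [/\ 0 <= s <= x, x < t <= 1, s = 0 \/ section_parameter i s,
      t = 1 \/ section_parameter i t
    & forall r, s < r < t -> ~ section_parameter i r].
Proof.
have /finite_seqP[l lE] := finite_section_parameter i.
move=> /(seq_gap l)[s [t [sl tl sx xt gap]]]; exists s, t.
have inl r : r \in l <-> section_parameter i r by rewrite lE.
split => //.
- by move: sl; rewrite inE => /orP[/eqP->|/inl]; [left|right].
- by move: tl; rewrite inE => /orP[/eqP->|/inl]; [left|right].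
by move=> r srt /inl /gap[]; lra.
Qed.

(** * Refined sections as open intervals of an edge *)

Section SectionInterval.
Variables (i : 'I_n) (s t : R).
Hypotheses (s_ge0 : 0 <= s) (st : s < t) (t_le1 : t <= 1).
Hypothesis s_end : s = 0 \/ section_parameter i s.
Hypothesis t_end : t = 1 \/ section_parameter i t.
Hypothesis regular : forall r, s < r < t -> ~ section_parameter i r.

Local Notation S := [set ep i r | r in `]s, t[].
Local Notation A := (P `\` (section_points v `|` range v)).

Lemma section_end_notin r :
  r = s \/ r = t -> ~ A (ep i r).
Proof.
have s1 : s <= 1 := le_trans (ltW st) t_le1.
have t0 : 0 <= t := le_trans s_ge0 (ltW st).
move=> h [_]; apply; case: h => ->.
  case: s_end => [->|h]; first by right; exists i; rewrite ?edge_point0.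
  by left; apply/section_pointsP; rewrite ?s_ge0.
case: t_end => [->|h]; first by right; exists (ordS i); rewrite ?edge_point1.
by left; apply/section_pointsP; rewrite ?t_le1 ?andbT.
Qed.

Lemma section_interval_sub : S `<=` A.
Proof.
move=> _ [r + <-]; rewrite /= in_itv /= => rst.
have r01 : 0 < r < 1 by move: s_ge0 t_le1; lra.
have r01w : 0 <= r <= 1 by lra.
split; first exact: edge_point_curve.
case=> [/section_pointsP - /(_ r01w)|[j _]]; first exact: regular.
(* A vertex [v j] is the point of parameter 0 on edge [j]; disjointness forces [i = j], and then
   [r = 0]. *)
rewrite -edge_point0 => /esym e.
have ij : i = j by apply: (edge_interior_disjoint _ _ e); lra.
by move: e; rewrite ij => /edge_point_inj; lra.
Qed.

(** [S] is connected, so it lies in the component [C] of its midpoint; as [C] meets [S] in a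
    nonempty subset both open and closed in [C], the two are equal. *)
Lemma section_interval_refined : refined_section v S.
Proof.
have mid : S (ep i ((s + t) / 2)).
  by exists ((s + t) / 2) => //=; rewrite in_itv /=; move: st; lra.
exists (ep i ((s + t) / 2)); first exact: section_interval_sub.
have cS : connected S.
  apply: connected_continuous_connected.
    by apply/connected_intervalP; exact: interval_is_interval.
  by apply: continuous_subspaceT => r; exact: edge_point_continuous.
apply/seteqP; split.
  by apply: connected_component_max => //; exact: section_interval_sub.
set C := connected_component _ _.
have CA : C `<=` A by exact: connected_component_sub.
suff <- : C `&` S = C by move=> z [].
apply: (@component_connected _ A (ep i ((s + t) / 2))).
- exists (ep i ((s + t) / 2)); split => //.
  by apply: connected_component_refl; exact: section_interval_sub.
(* Openness: [F] is the rest of the curve, namely the other edges and the two outer closed pieces of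
   edge [i]. It is closed and disjoint from [S]. *)
- pose F := (\bigcup_(j in [set j | j != i]) [set ep j r | r in `[0, 1]]) `|`
            ([set ep i r | r in `[0, s]] `|` [set ep i r | r in `[t, 1]]).
  have cF : closed F.
    apply: closedU; last by apply: closedU; exact: closed_edge_segment.
    by apply: closed_bigcup => *; [exact: finite_finset|exact: closed_edge_segment].
  exists (~` F); first by rewrite openC.
  apply/seteqP; split=> z [Cz].
    move=> [r + zr]; move: Cz; rewrite -{}zr => Cz.
    rewrite /= in_itv /= => rst; split=> //.
    move=> [[j /= ji [u + e]]|[[u + /edge_point_inj e]|[u + /edge_point_inj e]]];
      rewrite /= in_itv /= => u01; [|lra|lra].
    move: ji; rewrite -(@edge_interior_disjoint i j r u) ?eqxx //;
      move: s_ge0 t_le1; lra.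
  move=> nF; split=> //; have [[j [r r01 zr]] _] := CA _ Cz.
  have [ji|ji] := eqVneq j i; last first.
    by case: nF; left; exists j => //; exists r; rewrite //= in_itv.
  rewrite zr ji in nF *; exists r; rewrite //= in_itv /=.
  apply/andP; split; rewrite ltNge; apply/negP => h; apply: nF; right.
    by left; exists r; rewrite //= in_itv /=; lra.
  by right; exists r; rewrite //= in_itv /=; lra.
(* Closedness: [closure S] adds only the two ends, and these are not in [A]. *)
- exists (closure S); first exact: closed_closure.
  apply/seteqP; split=> z [Cz].
    by move=> Sz; split=> //; exact: subset_closure.
  rewrite closure_edge_interval// => -[r + zr]; rewrite /= in_itv /= => rst.
  split=> //; exists r; rewrite //= in_itv /= !lt_neqAle.
  have := CA _ Cz; rewrite -zr => Ar.
  case/andP: rst => -> ->; rewrite !andbT; apply/andP; split; apply/eqP => e.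
    by apply: (@section_end_notin r); [left|].
  by apply: (@section_end_notin r); [right|].
Qed.

(** Take a vertex farthest from the midpoint [m]. A tie at [m] would make [m] a section parameter,
    so the maximum is strict there, and constancy of sign carries it to all of [S]. *)
Lemma section_interval_farthest : exists y, farthest_vertex v S y.
Proof.
set m := (s + t) / 2; have mst : s < m < t by rewrite /m; move: st; lra.
case: (arg_maxP (fun j => sqdist (ep i m) (v j)) (isT : predT i)) => a _ amax.
have vertex_lt r b : s < r < t -> b != a ->
    sqdist (ep i r) (v b) < sqdist (ep i r) (v a).
  move=> rst ba; rewrite -subr_gt0 sqdist_diff_affine.
  apply: (@affine_constant_sign _ _ _ s t m r) => // [u ust|]; last first.
    rewrite -sqdist_diff_affine subr_gt0 lt_neqAle (amax b isT : _ <= _) andbT.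
    by apply/eqP => h; apply: (@regular m) => //; exists b, a.
  rewrite -sqdist_diff_affine subr_eq0; apply/eqP => h.
  by apply: (@regular u) => //; exists a, b; rewrite eq_sym.
exists (v a); split; first by exists a.
have vertex_le r b : s < r < t -> sqdist (ep i r) (v b) <= sqdist (ep i r) (v a).
  by move=> rst; have [->//|ba] := eqVneq b a; exact/ltW/vertex_lt.
move=> _ q [r + <-]; rewrite /= in_itv /= => rst Pq.
rewrite ltr_eucl_dist.
have [[b _ <-] ba|[b lt_b] _] := vertex_or_closer (ep i r) Pq.
  by apply: vertex_lt => //; apply: contraNneq ba => ->.
exact: lt_le_trans lt_b (vertex_le _ _ rst).
Qed.

End SectionInterval.

End Edges.

(** * Infima of distances and the distinguished chord *)

Lemma delta_le {R : realType} (T : set 'rV[R]_2) p r : T p ->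
  (forall q, T q -> eucl_dist p q <= r) -> delta T <= r.
Proof.
move=> Tp pr; apply: (@le_trans _ _ (sup [set eucl_dist p q | q in T])).
  apply: ge_inf; last by exists p.
  exists 0 => _ [p' Tp' <-].
  (* Where no supremum exists [sup] has the default value 0, so 0 is a lower bound in both cases. *)
  have [hs|/sup_out->//] := pselect (has_sup [set eucl_dist p' q | q in T]).
  apply: (le_trans (eucl_dist_ge0 p' p')).
  by apply: sup_upper_bound => //; exists p'.
apply: ge_sup; first by exists (eucl_dist p p), p.
by move=> _ [q Tq <-]; exact: pr.
Qed.

Lemma dist_to_set_closure {R : realType} (T : set 'rV[R]_2) p z : closure T p ->
  (forall q, T q -> eucl_dist p z <= eucl_dist q z) ->
  dist_to_set T z = eucl_dist p z.
Proof.
move=> Tp pmin; have [q Tq] : T !=set0.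
  by have [q []] := Tp setT filterT; exists q.
apply/eqP; rewrite eq_le; apply/andP; split; last first.
  by apply: lb_le_inf; [exists (eucl_dist q z), q | move=> _ [q' /pmin ? <-]].
apply: (closure_eucl_dist_ge Tp) => q' Tq'; apply: ge_inf; last by exists q'.
by exists 0 => _ [q'' _ <-]; exact: eucl_dist_ge0.
Qed.

Theorem lemma5p3 (R : realType) (n : nat) (v : 'I_n -> 'rV[R]_2)
  (v_convex : convex_polygon v) (p0 q0 : 'rV[R]_2)
  (p0q0 : distinguished (polygon_curve v) p0 q0) :
  exists (S : set 'rV[R]_2) (y : 'rV[R]_2),
    [/\ refined_section v S,
        farthest_vertex v S y,
        delta (polygon_curve v) = dist_to_set S y
      & [/\ nearest_point (closure S) y p0,
            delta (polygon_curve v) = eucl_dist p0 y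
          & q0 = y]
        \/
        [/\ initial_point v S p0,
            range v q0,
            q0 != p0,
            delta (polygon_curve v) = eucl_dist p0 y
          & delta (polygon_curve v) = eucl_dist p0 q0]].
Proof.
have [Pp0 Pq0 dE q0max] := p0q0.
have [i [x [x01 p0E]]] : exists i x, 0 <= x < 1 /\ p0 = edge_point v i x.
  have [j [u u01 p0E]] := Pp0.
  (* A point of parameter 1 is taken as parameter 0 of the next edge, so that a vertex is the start
     of its edge, as an initial point must be. *)
  have [u1|u1] := eqVneq u 1; last first.
    by exists j, u; split=> //; rewrite lt_neqAle u1 andbA andbAC andbT.
  exists (ordS j), 0; split; first by rewrite lexx ltr01.
  by rewrite edge_point0 -edge_point1 -u1.
have [s [t [sx xt s_end t_end regular]]] := section_interval v_convex i x01.
have s_ge0 : 0 <= s by lra.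
have st : s < t by lra.
have t_le1 : t <= 1 by lra.
have [y yfar] := section_interval_farthest v_convex st regular.
have refS := section_interval_refined v_convex s_ge0 st t_le1 s_end t_end regular.
set S := [set edge_point v i r | r in `]s, t[] in yfar refS *.
have SP : S `<=` polygon_curve v.
  move=> _ [r + <-]; rewrite /= in_itv /= => rst.
  by apply: edge_point_curve; lra.
have [[k _ yk] yS] := yfar.
have Py : polygon_curve v y by rewrite -yk; exact: vertex_curve.
have clS : closure S = [set edge_point v i r | r in `[s, t]].
  exact: closure_edge_interval.
have clSp0 : closure S p0.
  by rewrite clS p0E; exists x; rewrite //= in_itv /=; lra.
have delta_S p : closure S p -> delta (polygon_curve v) <= eucl_dist p y.
  move=> /closure_eucl_dist_ge; apply=> {}p Sp.
  apply: (delta_le (SP p Sp)) => q Pq.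
  by have [->//|qy] := eqVneq q y; exact/ltW/yS.
have dy : delta (polygon_curve v) = eucl_dist p0 y.
  by apply/eqP; rewrite eq_le delta_S// dE q0max.
exists S, y; split=> //.
  rewrite (dist_to_set_closure clSp0) // => q Sq; rewrite -dy.
  by apply: delta_S; exact: subset_closure.
have [q0y|q0y] := eqVneq q0 y.
  left; split=> //; split=> // p clSp pp0.
  (* A second point [p] of the closure at distance at most delta would tie with [p0]. Their midpoint
     is again in the closure and strictly closer to [y], against [delta_S]. *)
  rewrite ltNge -dy; apply/negP => p_le.
  have /eqP dp : eucl_dist p y == eucl_dist p0 y by rewrite -dy eq_le p_le delta_S.
  have sq : sqdist p y = sqdist p0 y.
    by apply/eqP; rewrite eq_le -!ler_eucl_dist dp lexx.
  have := sqdist_midpoint_lt pp0 sq; rewrite -ltr_eucl_dist dp -dy ltNge.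
  move=> /negP; apply; apply: delta_S.
  move: clSp clSp0; rewrite clS => -[r + <-] [r0 + <-].
  rewrite -edge_point_convex /= !in_itv /= => rst r0st.
  by eexists; last reflexivity; rewrite /= in_itv /=; lra.
right; split=> //; last 2 first.
- have [//|[a]] := vertex_or_closer v_convex p0 Pq0.
  by rewrite -ltr_eucl_dist ltNge q0max//; exact: vertex_curve.
(* If [q0 = p0], the greatest distance from [p0] is 0 and all vertices coincide. *)
- apply/eqP => e; have vp0 j : v j = p0.
    apply/eqP/negPn; rewrite eq_sym -eucl_dist_gt0 -leNgt.
    by rewrite (le_trans (q0max _ (vertex_curve v j)))// e leNgt eucl_dist_gt0 eqxx.
  by have := edge_nondegenerate v_convex k; rewrite !vp0 eqxx.
exists i, s, t; split=> //.
rewrite p0E; congr edge_point; apply/eqP; rewrite eq_le.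
case/andP: sx => _ ->; rewrite andbT leNgt; apply/negP => sltx.
(* If [s < x], then [p0] is in [S] and [q0] is strictly closer to it than [y], although both
   distances equal delta. *)
have /yS : S p0 by exists x; rewrite //= in_itv /= sltx; case/andP: xt.
by move=> /(_ q0 Pq0 q0y); rewrite -dy dE ltxx.
Qed.
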